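(* There is an absolute constant $K>0$ such that the following holds. Let $\mathbb{N}_{odd}$ be the set of odd positive integers and let $g : \mathbb{N}_{odd} \rightarrow \mathbb{N}_{odd}$ be an increasing function satisfying $g(x) > x$ for all $x$. Let $\ell_1 \geq 3$ be an odd number and define a sequence $(\ell_i)_{i \geq 1}$ inductively by $\ell_{i+1} = g(\ell_i)$. Let $L = \{\ell_i : i \geq 1\}$. Then for every $0<\varepsilon \leq \frac{1}{4\ell_1}$, $$w_{L}(\varepsilon) \leq K\varepsilon^{-8} \cdot g(4/\varepsilon) \cdot \log(g(4/\varepsilon)),$$ where $g(4/\varepsilon)$ denotes the value of $g$ at the largest odd integer not exceeding $4/\varepsilon$.
   Context: All graphs are finite and simple; $C_\ell$ denotes the cycle of length $\ell$. A graph is $\{C_\ell:\ell\in L\}$-free if it contains no $C_\ell$ with $\ell\in L$ as a (not necessarily induced) subgraph. An $n$-vertex graph $G$ is $\varepsilon$-far from being $\{C_\ell:\ell\in L\}$-free if one must delete at least $\varepsilon n^2$ edges of $G$ to make it $\{C_\ell:\ell\in L\}$-free. For a set $L$ of positive integers, $w_L(\varepsilon)$ is the smallest integer $q$ for which there is $n_0$ (depending on $\varepsilon$ and $L$) such that: if a graph $G$ on $n \geq n_0$ vertices is $\varepsilon$-far from being $\{C_{\ell} : \ell \in L\}$-free, then with probability at least $2/3$, a sample of $q$ vertices of $G$ (taken uniformly and independently) spans a subgraph containing a copy of $C_{\ell}$ for some $\ell \in L$. *)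

(* Defs.v *)
From mathcomp Require Import all_boot all_order all_algebra.
From mathcomp Require Import boolp classical_sets reals.

Set Implicit Arguments.
Unset Strict Implicit.
Unset Printing Implicit Defensive.

Import Order.TTheory GRing.Theory Num.Theory.

Local Open Scope ring_scope.

Record sgraph (V : finType) := SGraph {
  adj :> rel V;
  adj_sym : symmetric adj;
  adj_irr : irreflexive adj
}.

Definition edges (V : finType) (G : sgraph V) : {set {set V}} :=
  [set [set p.1; p.2]%SET | p in [pred p : V * V | G p.1 p.2]]%SET.

Section Subgraphs.
Variables (V : finType) (G : sgraph V).

Section Delete.
Variable F : {set {set V}}.

Definition delete_adj : rel V :=
  fun x y => G x y && ([set x; y]%SET \notin F).

Lemma delete_sym : symmetric delete_adj.
Proof. by move=> x y; rewrite /delete_adj adj_sym finset.setUC. Qed.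

Lemma delete_irr : irreflexive delete_adj.
Proof. by move=> x; rewrite /delete_adj adj_irr. Qed.

Definition delete_edges : sgraph V := SGraph delete_sym delete_irr.

End Delete.

Section Induced.
Variable X : {set V}.

Definition induced_adj : rel {x : V | x \in X} :=
  fun x y => G (val x) (val y).

Lemma induced_sym : symmetric induced_adj.
Proof. by move=> x y; exact: adj_sym. Qed.

Lemma induced_irr : irreflexive induced_adj.
Proof. by move=> x; exact: adj_irr. Qed.

Definition induced : sgraph {x : V | x \in X} := SGraph induced_sym induced_irr.

End Induced.

End Subgraphs.

(* [ucycle G s] alone would accept an edge as a 2-cycle and [::] as a 0-cycle. *)
Definition has_cycle (V : finType) (G : sgraph V) (l : nat) : Prop :=
  (3 <= l)%N /\ exists2 s : seq V, size s = l & ucycle G s.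

Definition has_cycle_in (L : set nat) (V : finType) (G : sgraph V) : Prop :=
  exists2 l : nat, L l & has_cycle G l.

Definition cycles_free (L : set nat) (V : finType) (G : sgraph V) : Prop :=
  ~ has_cycle_in L G.

Definition far_from_free (R : realType) (L : set nat) (eps : R)
    (V : finType) (G : sgraph V) : Prop :=
  forall F : {set {set V}}, F \subset edges G ->
    cycles_free L (delete_edges G F) ->
    eps * #|V|%:R ^+ 2 <= #|F|%:R.

(* The q vertices are drawn with replacement, hence uniformly over the
   #|V| ^ q maps 'I_q -> V. *)
Definition sample_prob (R : realType) (V : finType) (q : nat)
    (P : {set V} -> Prop) : R :=
  #|[pred x : {ffun 'I_q -> V} | `[< P [set x i | i : 'I_q]%SET >]]|%:R
  / (#|V| ^ q)%:R.

Definition sample_suffices (R : realType) (L : set nat) (eps : R) (q : nat)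
    : Prop :=
  exists n0 : nat, forall (V : finType) (G : sgraph V),
    (n0 <= #|V|)%N -> far_from_free L eps G ->
    2 / 3 <= sample_prob R q (fun X => has_cycle_in L (induced G X)).

(* [is_w L eps q] states that w_L(eps) is defined and equal to q. *)
Definition is_w (R : realType) (L : set nat) (eps : R) (q : nat) : Prop :=
  sample_suffices L eps q /\
  forall q' : nat, sample_suffices L eps q' -> (q <= q')%N.

(* Meaningful for 1 <= x; otherwise the empty maximum gives 0. *)
Definition largest_odd (R : realType) (x : R) : nat :=
  \max_(k < (Num.truncn x).+1 | odd k) k.

(* Main.v *)
(* Let k be the first element of L exceeding 4/eps; then k <= g(4/eps), and since
   all of L is odd, every 2-colouring leaves 2 eps n^2 ordered monochromatic
   adjacent pairs.

   Discard the few edges xy with fewer than ~eps^3 n^2 paths x-a-b-y (by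
   Cauchy-Schwarz on closed 4-walks), and pass to a vertex set U in which no subset
   can be 2-coloured and cut off cheaply. Reveal the sample one vertex at a time.
   (1) From a root in U, the neighbourhood of the revealed connected set either
   spans many monochromatic edges, so that two more vertices close an odd walk, or
   sends out many edges, so that one more vertex enlarges it by ~eps^2 n.
   (2) An odd closed walk longer than k > 4/eps has many vertices with three
   neighbours on it, and such a vertex shortens it. (3) An odd cycle of length at
   most k is lengthened to exactly k by replacing an edge xy with a path, grown
   greedily inside a dense subgraph between the neighbourhoods of x and y.
   Each of these O(k + eps^-2) advances has conditional probability at least
   ~eps^3, so O(eps^-3 (k + eps^-2)) samples suffice. *)

Require Import Defs.
From mathcomp Require Import all_boot all_order all_algebra.
From mathcomp Require Import boolp classical_sets reals exp.
From mathcomp Require Import fintype finset zify ring lra.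

Set Implicit Arguments.
Unset Strict Implicit.
Unset Printing Implicit Defensive.

Import Order.TTheory GRing.Theory Num.Theory.

Local Open Scope ring_scope.

(** * Adaptive search in a random sample *)

Section Sampling.
Local Open Scope set_scope.
Variables (R : realFieldType) (V : finType) (p : R) (goal : {set V} -> Prop).
Hypothesis goalS : forall S S' : {set V}, S \subset S' -> goal S -> goal S'.

(** The budget [j] counts useful vertices, not draws: a draw outside the good set costs nothing,
    since winning is monotone in [S]. The search can thus be described without probability, which
    enters only in [failing_samples]. *)
Fixpoint winning (j : nat) (S : {set V}) : Prop :=
  goal S \/
  if j is j'.+1 then p * #|V|%:R <= #|[set x | `[< winning j' (x |: S) >]]|%:R
  else False.

Lemma winning_goal j S : goal S -> winning j S.
Proof. by case: j => [|j] gS; left. Qed.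

Lemma winning_step j (S A : {set V}) : p * #|V|%:R <= #|A|%:R ->
  (forall x, x \in A -> winning j (x |: S)) -> winning j.+1 S.
Proof.
move=> pA wA; right; apply: le_trans pA _; rewrite ler_nat subset_leq_card //.
by apply/subsetP => x /wA wx; rewrite inE; apply/asboolP.
Qed.

Lemma winning_leq j j' (S : {set V}) : (j <= j')%N -> winning j S -> winning j' S.
Proof.
elim: j j' S => [|j IH] [|j'] S //= lejj'.
- by case=> // gS; left.
- case=> [gS|wS]; [by left|].
  by apply: winning_step wS _ => x; rewrite inE => /asboolP /IH; apply.
Qed.

Lemma winning_sub j (S S' : {set V}) : S \subset S' -> winning j S -> winning j S'.
Proof.
elim: j S S' => [|j IH] S S' sS /=.
- by case=> // gS; left; exact: goalS gS.
- case=> [gS|wS]; [by left; exact: goalS gS|].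
  apply: winning_step wS _ => x; rewrite inE => /asboolP; apply: IH.
  exact: setUS.
Qed.

Definition ffun_cons N (x : V) (f : {ffun 'I_N -> V}) : {ffun 'I_N.+1 -> V} :=
  [ffun i => if unlift ord0 i is Some i' then f i' else x].

Lemma imset_ffun_cons N (x : V) (f : {ffun 'I_N -> V}) :
  [set ffun_cons x f i | i : 'I_N.+1] = x |: [set f i | i : 'I_N].
Proof.
apply/setP => y; rewrite inE; apply/imsetP/orP => [[i _ ->]|[]].
- rewrite ffunE; case: unliftP => [i' _|_]; last by left; rewrite inE.
  by right; apply/imsetP; exists i'.
- by rewrite inE => /eqP ->; exists ord0; rewrite // ffunE unlift_none.
- by case/imsetP => i _ ->; exists (lift ord0 i); rewrite // ffunE liftK.
Qed.

Lemma card_ffun_cons N (P : pred {ffun 'I_N.+1 -> V}) :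
  #|[pred f | P f]| = (\sum_x #|[pred f : {ffun 'I_N -> V} | P (ffun_cons x f)]|)%N.
Proof.
transitivity (\sum_x \sum_(f : {ffun 'I_N -> V} | P (ffun_cons x f)) 1)%N; last first.
  by apply: eq_bigr => x _; rewrite sum1dep_card; apply: eq_card => f; rewrite !inE.
rewrite -sum1_card (pair_big_dep xpredT (fun x f => P (ffun_cons x f)) (fun=> fun=> 1%N)) /=.
rewrite (reindex (fun u : V * {ffun 'I_N -> V} => ffun_cons u.1 u.2)) //=.
exists (fun f : {ffun 'I_N.+1 -> V} => (f ord0, [ffun i => f (lift ord0 i)])).
- move=> [x f] _ /=; congr pair; first by rewrite ffunE unlift_none.
  by apply/ffunP => i; rewrite !ffunE liftK.
- move=> f _; apply/ffunP => i; rewrite ffunE /=.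
  by case: unliftP => [j ->|->]; rewrite ?ffunE.
Qed.

(* Markov's inequality for 2^(j - number of advances): each advance has
   probability at least p, so a step multiplies its mean by at most 1 - p/2. *)
Lemma failing_samples N j (S : {set V}) : 0 <= p <= 1 -> winning j S ->
  #|[pred f : {ffun 'I_N -> V} | ~~ `[< goal (S :|: [set f i | i : 'I_N]) >]]|%:R
    <= 2 ^+ j * ((1 - p / 2) * #|V|%:R) ^+ N.
Proof.
move=> p01; have r0 : 0 <= (1 - p / 2) * #|V|%:R.
  by rewrite mulr_ge0 //; lra.
elim: N j S => [|N IH] j S wS.
  rewrite expr0 mulr1; apply: (@le_trans _ _ 1); last by rewrite exprn_ege1 //; lra.
  by rewrite -[1]/(1%:R) ler_nat (leq_trans (max_card _)) // card_ffun card_ord expn0.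
case: (pselect (goal S)) => [gS|ngS].
  rewrite eq_card0; first by rewrite mulr_ge0 // exprn_ge0.
  by move=> f; rewrite inE; apply/negbTE; rewrite negbK; apply/asboolP;
     apply: goalS gS; exact: subsetUl.
case: j wS => [|j] wS; first by case: wS.
set A := [set x | `[< winning j (x |: S) >]]%SET.
have pA : p * #|V|%:R <= #|A|%:R by case: wS.
rewrite card_ffun_cons natr_sum.
set h := ((1 - p / 2) * #|V|%:R) ^+ N.
have h0 : 0 <= h by rewrite exprn_ge0.
(* Condition on the first draw: in [A] it lowers the budget by one, elsewhere [winning_sub] keeps
   the budget unchanged. *)
apply: (@le_trans _ _ (\sum_(x in A) 2 ^+ j * h + \sum_(x in ~: A) 2 ^+ j.+1 * h)).
  rewrite (bigID (mem A)) /= lerD //.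
    apply: ler_sum => x; rewrite inE => /asboolP wx.
    apply: le_trans (IH _ _ wx); rewrite ler_nat subset_leq_card //.
    by apply/subsetP => f; rewrite !inE imset_ffun_cons setUA [_ :|: [set x]]setUC.
  rewrite [X in _ <= X](eq_bigl (fun x => x \notin A)); last by move=> x; rewrite inE.
  apply: ler_sum => x _.
  have wx : winning j.+1 (x |: S) by apply: winning_sub wS; exact: subsetUr.
  apply: le_trans (IH _ _ wx); rewrite ler_nat subset_leq_card //.
  by apply/subsetP => f; rewrite !inE imset_ffun_cons setUA [_ :|: [set x]]setUC.
have cA : #|~: A|%:R = #|V|%:R - #|A|%:R :> R.
  by rewrite cardsCs setCK natrB ?max_card.
rewrite !sumr_const -[_ *+ #|A|]mulr_natr -[_ *+ #|~: A|]mulr_natr cA !exprS -/h.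
set c := 2 ^+ j * h.
have c0 : 0 <= c by rewrite mulr_ge0 // exprn_ge0.
have : 0 <= c * (#|A|%:R - p * #|V|%:R) by rewrite mulr_ge0 ?subr_ge0.
have -> : 2 * 2 ^+ j * h = 2 * c by rewrite mulrA.
have -> : 2 * 2 ^+ j * ((1 - p / 2) * #|V|%:R * h) = c * (2 - p) * #|V|%:R.
  by rewrite /c; field.
lra.
Qed.

End Sampling.

(** * Odd closed walks *)

Section Walks.
Local Open Scope nat_scope.
Variable V : eqType.
Implicit Types (s t : seq V) (e : rel V).

Lemma split_count (a : pred V) s : 0 < count a s ->
  exists s1 x s2, [/\ s = s1 ++ x :: s2, a x & count a s = (count a s2).+1].
Proof.
elim: s => [|y s IH] //=; case: (boolP (a y)) => [ay _|_].
  by exists [::], y, s; split.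
rewrite add0n => /IH [s1 [x [s2 [-> ax ->]]]].
by exists (y :: s1), x, s2; split.
Qed.

Lemma dup_split s : ~~ uniq s -> exists x s1 s2 s3, s = s1 ++ x :: s2 ++ x :: s3.
Proof.
elim: s => [|y s IH] //=; rewrite negb_and negbK => /orP[ys|/IH].
  by case/splitPr: ys => s2 s3; exists y, [::], s2, s3.
by case=> [x [s1 [s2 [s3 ->]]]]; exists x, (y :: s1), s2, s3.
Qed.

Lemma cycle_cat e x s y t :
  cycle e ((x :: s) ++ y :: t) = path e x (rcons s y) && path e y (rcons t x).
Proof. by rewrite /= rcons_cat -cat_rcons cat_path last_rcons. Qed.

(** A repeated vertex splits a closed walk into two shorter ones whose lengths add up, so one of
    them is odd; induct on the length. *)
Lemma odd_ucycle e s : cycle e s -> odd (size s) ->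
  exists t, [/\ ucycle e t, odd (size t), size t <= size s & {subset t <= s}].
Proof.
have [n] := ubnP (size s); elim: n s => // n IH s; rewrite ltnS => sn cs os.
have [us|/dup_split [x [s1 [s2 [s3 es]]]]] := boolP (uniq s).
  by exists s; split => //; apply/andP.
have {}cs : cycle e ((x :: s2) ++ x :: (s3 ++ s1)).
  by move: cs; rewrite es -(rot_cycle (size s1)) rot_size_cat /= -!catA.
have [c1 c2] : cycle e (x :: s2) /\ cycle e (x :: s3 ++ s1).
  by move: cs; rewrite cycle_cat => /andP.
have sz : size s = size (x :: s2) + size (x :: s3 ++ s1).
  by rewrite es !size_cat /= !size_cat /=; lia.
have [o1|o1] := boolP (odd (size (x :: s2))).
- have [|t [ut ot st tS]] := IH _ _ c1 o1.
    by move: sz sn => /=; lia.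
  exists t; split => //; first by move: sz st => /=; lia.
  move=> y /tS; rewrite es !(inE, mem_cat) => /orP[->|->]; by rewrite ?orbT.
- have o2 : odd (size (x :: s3 ++ s1)).
    by move: os; rewrite sz oddD (negbTE o1).
  have [|t [ut ot st tS]] := IH _ _ c2 o2.
    by move: sz sn => /=; lia.
  exists t; split => //; first by move: sz st => /=; lia.
  move=> y /tS; rewrite es !(inE, mem_cat).
  by case/or3P=> ->; rewrite ?orbT.
Qed.

(* Three neighbours of [w] cut the walk into three arcs; as their lengths have an
   odd sum, one of them is odd and can be closed up through [w]. *)
Lemma shorten_cycle e s w : symmetric e -> cycle e s -> odd (size s) ->
    4 < size s -> 2 < count (e w) s ->
  exists t, [/\ cycle e t, odd (size t), size t < size s & {subset t <= w :: s}].
Proof.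
move=> esym cs os s4 c3.
have [t0 [a [r0 [es0 wa ca]]]] : exists s1 x s2, [/\ s = s1 ++ x :: s2, e w x
  & count (e w) s = (count (e w) s2).+1] by apply: split_count; lia.
have [s1 [b [r1 [er0 wb cb]]]] : exists s1 x s2, [/\ r0 = s1 ++ x :: s2, e w x
  & count (e w) r0 = (count (e w) s2).+1] by apply: split_count; lia.
have [s2 [c [s3 [er1 wc _]]]] : exists s1 x s2, [/\ r1 = s1 ++ x :: s2, e w x
  & count (e w) r1 = (count (e w) s2).+1] by apply: split_count; lia.
have {ca cb} es : s = t0 ++ a :: s1 ++ b :: s2 ++ c :: s3 by rewrite es0 er0 er1.
have {}cs : cycle e (a :: s1 ++ b :: s2 ++ c :: s3 ++ t0).
  move: cs; rewrite es -(rot_cycle (size t0)) rot_size_cat .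
  by rewrite /= -!catA /= -!catA.
move: cs; rewrite -cat_cons cycle_cat rcons_cat -cat_rcons cat_path last_rcons.
case/and3P=> p1 p2 p3.
have sz : size s = size s1 + size s2 + size (s3 ++ t0) + 3.
  by rewrite es !size_cat /= size_cat /= size_cat /=; lia.
have cyc x r y : e w x -> e w y -> path e x (rcons r y) -> cycle e [:: w, x & rcons r y].
  by move=> wx wy pr; rewrite /= rcons_path wx pr last_rcons esym wy.
have sub x r y : x \in s -> y \in s -> {subset r <= s} ->
    {subset [:: w, x & rcons r y] <= w :: s}.
  move=> xs ys rs z; rewrite !inE mem_rcons inE => /or4P[->//|/eqP->|/eqP->|/rs->];
  by rewrite ?xs ?ys orbT.
have [as_ bs cs] : [/\ a \in s, b \in s & c \in s].
  by rewrite es !(inE, mem_cat) !eqxx ?orbT; split; rewrite ?orbT.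
have [s1s s2s s3s] : [/\ {subset s1 <= s}, {subset s2 <= s} & {subset s3 ++ t0 <= s}].
  by split=> z; rewrite es !(inE, mem_cat) => zs; rewrite ?zs ?orbT //;
     case/orP: zs => ->; rewrite ?orbT.
(* An arc with interior [r] closes through [w] to a walk of length [size r + 3]. The three interiors
   have even total [size s - 3], so one is even. If closing it gains nothing, the other two are
   empty, and an empty one gives length 3, a gain since [4 < size s]. *)
pose good (r : seq V) := ~~ odd (size r) && (size r + 3 < size s).
have [u1|u1] := boolP (good s1).
  case/andP: u1 => o1 l1; exists [:: w, a & rcons s1 b]; split; first exact: cyc.
  - by rewrite /= size_rcons /= negbK.
  - by rewrite /= size_rcons; lia.
  - exact: sub.
have [u2|u2] := boolP (good s2).
  case/andP: u2 => o1 l1; exists [:: w, b & rcons s2 c]; split; first exact: cyc.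
  - by rewrite /= size_rcons /= negbK.
  - by rewrite /= size_rcons; lia.
  - exact: sub.
have [u3|u3] := boolP (good (s3 ++ t0)).
  case/andP: u3 => o1 l1; exists [:: w, c & rcons (s3 ++ t0) a]; split; first exact: cyc.
  - by rewrite /= size_rcons /= negbK.
  - by rewrite /= size_rcons; lia.
  - exact: sub.
by move: u1 u2 u3; rewrite /good; lia.
Qed.
End Walks.

(** * Averaging and counting short walks *)

Section Counting.
Variables (R : realFieldType) (V : finType).
Local Notation n := (#|V|%:R : R).

Lemma sqr_sum_le (I : finType) (f : I -> R) :
  (\sum_i f i) ^+ 2 <= #|I|%:R * \sum_i f i ^+ 2.
Proof.
have [I0|I0] := posnP #|I|.
  rewrite I0 mul0r big1 ?expr0n // => i _.
  by have := fintype0 i I0.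
have N0 : 0 < #|I|%:R :> R by rewrite ltr0n.
set s := \sum_i f i; set q := \sum_i f i ^+ 2.
have : 0 <= \sum_i (#|I|%:R * f i - s) ^+ 2 by apply: sumr_ge0 => i _; apply: sqr_ge0.
have -> : \sum_i (#|I|%:R * f i - s) ^+ 2 = #|I|%:R * (#|I|%:R * q - s ^+ 2).
  transitivity (\sum_i (#|I|%:R ^+ 2 * f i ^+ 2 - 2 * #|I|%:R * s * f i + s ^+ 2)).
    by apply: eq_bigr => i _; ring.
  rewrite !big_split /= sumrN -!mulr_sumr -/s -/q sumr_const -mulr_natr; ring.
by rewrite pmulr_rge0 // subr_ge0.
Qed.

Lemma natr_card_sum (P : pred V) : #|[set x | P x]|%:R = \sum_x (P x)%:R :> R.
Proof.
by rewrite -sum1dep_card natr_sum big_mkcond; apply: eq_bigr => x _; case: ifP.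
Qed.

Lemma card_pairs (P : rel V) :
  #|[set u : V * V | P u.1 u.2]| = (\sum_x #|[set y | P x y]|)%N.
Proof.
transitivity (\sum_x \sum_(y | P x y) 1)%N.
  by rewrite -sum1dep_card (pair_big_dep xpredT P (fun=> fun=> 1%N)).
by apply: eq_bigr => x _; rewrite sum1dep_card.
Qed.

Lemma card_pairs_sum (P : rel V) :
  #|[set u : V * V | P u.1 u.2]|%:R = \sum_x \sum_y (P x y)%:R :> R.
Proof.
by rewrite card_pairs natr_sum; apply: eq_bigr => x _; rewrite natr_card_sum.
Qed.

(** Averaging: a light row contributes less than [b * n], a heavy one at most [n]. This turns a
    dense set of pairs into many good choices for a single draw. *)
Lemma many_heavy_rows (P : rel V) (a b : R) : (0 < #|V|)%N -> 0 <= b ->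
  (a + b) * n ^+ 2 <= #|[set u : V * V | P u.1 u.2]|%:R ->
  a * n <= #|[set x | b * n <= #|[set y | P x y]|%:R]|%:R.
Proof.
move=> n0 b0; have {}n0 : 0 < n by rewrite ltr0n.
set A := [set x | _]; rewrite card_pairs natr_sum => H.
have: (a + b) * n ^+ 2 <= \sum_x ((x \in A)%:R * n + b * n).
  apply: le_trans H _; apply: ler_sum => x _.
  have [xA|] := boolP (x \in A).
    rewrite mul1r; apply: (@le_trans _ _ n); last by rewrite lerDl mulr_ge0 // ltW.
    by rewrite ler_nat max_card.
  by rewrite inE -ltNge mul0r add0r => /ltW.
rewrite big_split /= sumr_const -mulr_suml -natr_card_sum cardsE -[b * n *+ _]mulr_natr.
by move=> {}H; rewrite -(ler_pM2r n0); move: H; rewrite expr2; lra.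
Qed.

(** Walks of length three are counted, degenerate ones included, so that with the edge [x y] they
    form closed 4-walks, the quantity that Cauchy-Schwarz bounds below. *)
Definition good_edge (E : rel V) (delta : R) (x y : V) : bool :=
  delta * n ^+ 2 <= #|[set u : V * V | [&& E x u.1, E u.1 u.2 & E u.2 y]]|%:R.

Lemma good_edge_sym (E : rel V) (delta : R) : symmetric E -> symmetric (good_edge E delta).
Proof.
move=> Esym x y; congr (_ <= _).
rewrite !(card_pairs_sum (fun a b => [&& E _ a, E a b & E b _])) exchange_big /=.
apply: eq_bigr => a _; apply: eq_bigr => b _.
by rewrite (Esym y a) (Esym a b) (Esym b x) [in RHS]andbC -andbA andbCA.
Qed.

(* Bad edges would carry at least e^4/n^4 closed 4-walks (Cauchy-Schwarz twice),
   but each lies in fewer than delta n^2 of them. *)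
Lemma few_bad_edges (E : rel V) (theta : R) : symmetric E -> 0 <= theta ->
  #|[set u : V * V | E u.1 u.2 && ~~ good_edge E (theta ^+ 3) u.1 u.2]|%:R
    <= theta * n ^+ 2.
Proof.
move=> Esym th0; pose B x y := E x y && ~~ good_edge E (theta ^+ 3) x y.
have Bsym : symmetric B by move=> x y; rewrite /B Esym good_edge_sym.
have [V0|V0] := posnP #|V|.
  rewrite eq_card0 ?mulr_ge0 ?exprn_ge0 // => -[x y].
  by have := fintype0 x V0.
pose b x y : R := (B x y)%:R.
rewrite (card_pairs_sum B) -/b; set e := \sum_x _.
have b0 x y : 0 <= b x y by rewrite ler0n.
have e0 : 0 <= e by rewrite sumr_ge0 // => x _; rewrite sumr_ge0.
have n0 : 0 < n by rewrite ltr0n.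
(* In the graph of bad edges [e] counts ordered edges, [c] walks of length two and [h] closed
   4-walks. *)
pose h := \sum_x \sum_y (\sum_z b x z * b z y) ^+ 2.
pose c := \sum_x \sum_y \sum_z b x z * b z y.
have ec : e ^+ 2 <= n * c.
  apply: le_trans (sqr_sum_le _) _; rewrite ler_wpM2l ?ler0n // /c.
  rewrite [X in _ <= X](eq_bigr (fun x => \sum_z b x z * \sum_y b z y)); last first.
    by move=> x _; rewrite exchange_big /=; apply: eq_bigr => z _; rewrite mulr_sumr.
  rewrite exchange_big /= le_eqVlt; apply/orP; left; apply/eqP.
  apply: eq_bigr => z _; rewrite -mulr_suml expr2; congr (_ * _).
  by apply: eq_bigr => x _; rewrite /b Bsym.
have ch : c ^+ 2 <= n ^+ 2 * h.
  have -> : n ^+ 2 = #|{: V * V}|%:R by rewrite card_prod natrM expr2.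
  rewrite /c /h (pair_big xpredT xpredT (fun x y => \sum_z b x z * b z y)).
  rewrite (pair_big xpredT xpredT (fun x y => (\sum_z b x z * b z y) ^+ 2)).
  exact: (sqr_sum_le (fun u : V * V => \sum_z b u.1 z * b z u.2)).
(* Group the closed 4-walks by one bad edge [x z]; the other three edges form a walk in [E], and a
   bad edge has few of those. *)
have he : h <= e * (theta ^+ 3 * n ^+ 2).
  have -> : h = \sum_x \sum_z b x z * \sum_u \sum_y b x u * b u y * b y z.
    apply: eq_bigr => x _.
    transitivity (\sum_y \sum_z \sum_u b x z * (b x u * b u y * b y z)).
      apply: eq_bigr => y _; rewrite expr2 mulr_suml; apply: eq_bigr => z _.
      rewrite mulr_sumr; apply: eq_bigr => u _.
      by rewrite [b y z]/b Bsym -/(b z y); ring.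
    rewrite exchange_big /=; apply: eq_bigr => z _.
    rewrite exchange_big /= mulr_sumr; apply: eq_bigr => u _.
    by rewrite mulr_sumr.
  rewrite mulr_suml; apply: ler_sum => x _.
  rewrite mulr_suml; apply: ler_sum => z _.
  have [xzB|nB] := boolP (B x z); last by rewrite /b (negbTE nB) !mul0r.
  rewrite {1}/b xzB !mul1r; case/andP: xzB => _; rewrite -ltNge => /ltW.
  apply: le_trans; rewrite (card_pairs_sum (fun a b => [&& E x a, E a b & E b z])).
  apply: ler_sum => u _; apply: ler_sum => y _.
  rewrite -!natrM ler_nat !mulnb /B.
  by case: (E x u); case: (E u y); case: (E y z); rewrite ?andbF // leq_b1.
have [->|en0] := eqVneq e 0; first by rewrite mulr_ge0 // exprn_ge0 // ltW.
have {en0}e0 : 0 < e by rewrite lt_def en0.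
have c0 : 0 <= c.
  by do 3 (rewrite sumr_ge0 // => ? _); rewrite mulr_ge0.
have H : e ^+ 4 <= n ^+ 4 * (e * (theta ^+ 3 * n ^+ 2)).
  apply: (@le_trans _ _ ((n * c) ^+ 2)).
    rewrite -[4%N]/(2 * 2)%N exprM.
    by apply: lerXn2r ec; rewrite nnegrE ?sqr_ge0 // mulr_ge0 // ltW.
  rewrite exprMn -[n ^+ 4]/(n ^+ (2 + 2)) exprD -mulrA ler_wpM2l ?exprn_ge0 ?ler0n //.
  by apply: le_trans ch _; rewrite ler_wpM2l ?exprn_ge0 ?ler0n.
have : e ^+ 3 <= (theta * n ^+ 2) ^+ 3.
  rewrite -(ler_pM2l e0) -exprS; apply: le_trans H _.
  by rewrite le_eqVlt; apply/orP; left; apply/eqP; ring.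
by rewrite ler_pXn2r // nnegrE ?mulr_ge0 ?exprn_ge0 // ltW.
Qed.

End Counting.

(** * Extremal choices: a robust vertex set and a dense bipartite pair *)

Section Cleaning.
Variables (R : realFieldType) (V : finType).
Local Notation n := (#|V|%:R : R).

Lemma argmin_fin (T : finType) (t0 : T) (P : pred T) (f : T -> R) : P t0 ->
  exists2 t, P t & forall t', P t' -> f t <= f t'.
Proof. by move=> P0; case: (arg_minP f P0) => t Pt tm; exists t. Qed.

(* Among partial 2-colourings, with U the set of uncoloured vertices, minimise the
   number of edges that are not properly coloured and not inside U, minus
   2dn per coloured vertex. Minimality forbids colouring Z cheaply. *)
Lemma robust_core (F : rel V) (d : R) : symmetric F ->
    (forall c : pred V, 2 * d * n ^+ 2
       < #|[set u : V * V | F u.1 u.2 && (c u.1 == c u.2)]|%:R) ->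
  exists U : {set V}, U != set0 /\ forall (Z : {set V}) (c : pred V), Z \subset U ->
    2 * d * n * #|Z|%:R
      <= 2 * #|[set u : V * V | [&& F u.1 u.2, u.1 \in Z & u.2 \in U :\: Z]]|%:R
       + #|[set u : V * V | [&& F u.1 u.2, u.1 \in Z, u.2 \in Z & c u.1 == c u.2]]|%:R.
Proof.
move=> Fsym far.
(* [S.1] is the uncoloured set; outside it, membership in [S.2] is the colour. *)
pose bad (S : {set V} * {set V}) := [set u : V * V | [&& F u.1 u.2,
  ~~ ((u.1 \in S.1) && (u.2 \in S.1)) &
  [|| u.1 \in S.1, u.2 \in S.1 | (u.1 \in S.2) == (u.2 \in S.2)]]].
pose cost (S : {set V} * {set V}) : R := #|bad S|%:R - 2 * d * n * #|~: S.1|%:R.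
have [[U C] _ mUC] := @argmin_fin _ (setT, set0) xpredT cost isT.
exists U; split.
  (* Colouring nothing costs 0, so if [U] were empty, [C] would have at most [2 * d * n ^+ 2]
     monochromatic pairs. *)
  apply/eqP => U0; move: (far (mem C)); rewrite ltNge => /negP; apply.
  have := mUC (setT, set0) isT; rewrite /cost /= setCT cards0 mulr0 subr0 U0 setC0 cardsT.
  have -> : bad (setT, set0) = set0 by apply/setP => u; rewrite !inE andbF.
  rewrite cards0 subr_le0 -mulrA -expr2; congr (_%:R <= _).
  by apply: eq_card => u; rewrite !inE.
move=> Z c ZU.
pose C' := [set x | if x \in Z then c x else x \in C].
set A := [set u : V * V | _]; set B := [set u : V * V | _].
pose A' := [set u : V * V | [&& F u.1 u.2, u.2 \in Z & u.1 \in U :\: Z]].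
have cA' : #|A'| = #|A|.
  rewrite -(card_imset _ (_ : injective (fun u : V * V => (u.2, u.1)))); last by move=> [? ?] [? ?] [-> ->].
  apply: eq_card => -[x y]; apply/imsetP/idP => [[[a b]]|].
    by rewrite inE /= => H [-> ->]; rewrite inE /= Fsym.
  by rewrite inE /= Fsym => H; exists (y, x); rewrite // inE.
(* Pairs between [Z] and the vertices coloured earlier were already bad, having one end in [U]. *)
have sub : bad (U :\: Z, C') \subset bad (U, C) :|: A :|: A' :|: B.
  apply/subsetP => -[x y]; rewrite !inE /=.
  have xZU : x \in Z -> x \in U by move/(subsetP ZU).
  have yZU : y \in Z -> y \in U by move/(subsetP ZU).
  case: (F x y) => //=.
  move: xZU yZU; case: (x \in Z); case: (y \in Z); case: (x \in U); case: (y \in U)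
    => // xU yU; rewrite ?orbT ?orbF //=; by [case: (xU isT) | case: (yU isT)].
have cZ : #|~: (U :\: Z)|%:R = #|~: U|%:R + #|Z|%:R :> R.
  rewrite -natrD setDE setCI setCK cardsU.
  have -> : ~: U :&: Z = set0.
    by apply/setP => x; rewrite !inE; apply/andP => -[/negP xU /(subsetP ZU)].
  by rewrite cards0 subn0.
have cb : #|bad (U :\: Z, C')|%:R <= #|bad (U, C)|%:R + 2 * #|A|%:R + #|B|%:R :> R.
  rewrite mulr_natl mulr2n -{2}cA' -!natrD ler_nat.
  apply: leq_trans (subset_leq_card sub) _; rewrite !cardsU; lia.
have := mUC (U :\: Z, C') isT; rewrite /cost /= cZ; lra.
Qed.

(** Choose [A] and [B] inside the neighbourhoods of [x] and [y] to maximise the edges between them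
    minus [delta * n] per vertex; deleting a vertex of low degree would be an improvement. Finally
    [x] joins [B] as the start of a path: it sees all of [A]. *)
Lemma dense_core (E : rel V) (delta : R) (x y : V) : symmetric E -> 0 < delta ->
    3 * delta * n ^+ 2
      <= #|[set u : V * V | [&& E x u.1, E u.1 u.2 & E u.2 y]]|%:R ->
  (0 < #|V|)%N ->
  exists A B : {set V}, [/\ x \in B,
    forall b, b \in B -> (b == x) || E b y,
    forall b, b \in B -> delta * n <= #|[set a in A | E b a]|%:R &
    forall a, a \in A -> delta * n <= #|[set b in B | E a b]|%:R].
Proof.
move=> Esym d0 dense n0; have {}n0 : 0 < n by rewrite ltr0n.
pose e (S : {set V} * {set V}) :=
  #|[set u : V * V | [&& u.1 \in S.1, u.2 \in S.2 & E u.1 u.2]]|.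
pose cost (S : {set V} * {set V}) : R := delta * n * (#|S.1|%:R + #|S.2|%:R) - (e S)%:R.
pose P (S : {set V} * {set V}) := (S.1 \subset [set a | E x a]) && (S.2 \subset [set b | E b y]).
have P0 : P ([set a | E x a], [set b | E b y]) by rewrite /P !subxx.
have [[A B] /andP[/= AN BN] mAB] := @argmin_fin _ _ P cost P0.
have degA a : a \in A -> delta * n <= #|[set b in B | E a b]|%:R.
  move=> aA; have PA : P (A :\ a, B) by rewrite /P /= BN (subset_trans (subsetDl _ _)).
  have := mAB _ PA; rewrite /cost /= (cardsD1 a A) aA add1n -natr1.
  have : (e (A, B) <= e (A :\ a, B) + #|[set b in B | E a b]|)%N.
    rewrite -(card_imset [set b in B | E a b] (_ : injective (pair a))); last by move=> ? ? [].
    apply: leq_trans (leq_card_setU _ _); apply: subset_leq_card.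
    apply/subsetP => -[u v]; rewrite !inE /= => /and3P[uA vB uv]; rewrite uA vB uv !andbT.
    have [ua|//] := eqVneq u a.
    by apply/imsetP; exists v; rewrite ?inE ?vB -?ua.
  rewrite -(ler_nat R) natrD; lra.
have degB b : b \in B -> delta * n <= #|[set a in A | E b a]|%:R.
  move=> bB; have PB : P (A, B :\ b) by rewrite /P /= AN (subset_trans (subsetDl _ _)).
  have := mAB _ PB; rewrite /cost /= (cardsD1 b B) bB add1n -natr1.
  have : (e (A, B) <= e (A, B :\ b) + #|[set a in A | E b a]|)%N.
    rewrite -(card_imset [set a in A | E b a] (_ : injective (pair^~ b))); last by move=> ? ? [].
    apply: leq_trans (leq_card_setU _ _); apply: subset_leq_card.
    apply/subsetP => -[u v]; rewrite !inE /= => /and3P[uA vB uv]; rewrite uA vB uv !andbT.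
    have [vb|//] := eqVneq v b.
    by apply/imsetP; exists u; rewrite ?inE ?uA -?vb // Esym.
  rewrite -(ler_nat R) natrD; lra.
(* Without such an edge the cost would be nonnegative, while the full neighbourhoods cost at most
   [(2 - 3) * delta * n ^+ 2]. *)
have [[a b] /=] : exists u : V * V, [&& u.1 \in A, u.2 \in B & E u.1 u.2].
  apply/existsP; rewrite -[X in is_true X]negbK negb_exists; apply/forallP => AB0.
  have eAB : e (A, B) = 0%N.
    by apply: eq_card0 => u; rewrite inE; apply/negbTE; exact: AB0.
  have := mAB _ P0; rewrite /cost /= eAB.
  have -> : e ([set a | E x a], [set b | E b y])
      = #|[set u : V * V | [&& E x u.1, E u.1 u.2 & E u.2 y]]|.
    by apply: eq_card => u; rewrite !inE andbA andbAC -andbA.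
  have h (S : {set V}) : delta * n * #|S|%:R <= delta * n * n.
    by rewrite ler_wpM2l ?ler_nat ?max_card // mulr_ge0 // ltW.
  have h0 (S : {set V}) : 0 <= delta * n * #|S|%:R.
    by rewrite !mulr_ge0 // ltW.
  have := h [set a | E x a]; have := h [set b | E b y]; have := h0 A; have := h0 B.
  have : 0 < delta * n ^+ 2 by rewrite mulr_gt0 ?exprn_gt0.
  move: dense; rewrite expr2; lra.
move=> /and3P[aA bB ab].
exists A, (x |: B); split.
- by rewrite !inE eqxx.
- by move=> b'; rewrite !inE => /orP[->//|/(subsetP BN)]; rewrite inE => ->; rewrite orbT.
- move=> b'; rewrite !inE => /orP[/eqP->|]; last exact: degB.
  apply: le_trans (degB _ bB) _; rewrite ler_nat subset_leq_card //.
  apply/subsetP => z; rewrite !inE => /andP[zA _]; rewrite zA.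
  by have := subsetP AN z zA; rewrite inE.
- move=> a' /degA /le_trans; apply; rewrite ler_nat subset_leq_card //.
  by apply/subsetP => z; rewrite !inE => /andP[-> ->]; rewrite orbT.
Qed.

End Cleaning.

(** * The phases of the search for a cycle of length [k] *)

Section Phases.
Variables (R : realFieldType) (V : finType) (E : rel V) (p : R) (k : nat).
Hypotheses (Esym : symmetric E) (V0 : (0 < #|V|)%N).
Local Notation n := (#|V|%:R : R).

Definition cycle_in (S : {set V}) : Prop :=
  exists s : seq V, [/\ size s = k, ucycle E s & {subset s <= S}].

Local Notation winning := (winning p cycle_in).

Lemma fresh_vertices (delta : R) (N : {set V}) (t : seq V) : delta * n <= #|N|%:R ->
  (size t <= k)%N -> p * n + k%:R <= delta * n -> p * n <= #|N :\: [set z in t]|%:R.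
Proof.
move=> dN tk pk; have : (#|N| <= #|N :\: [set z in t]| + k)%N.
  have := cardsID [set z in t] N; have : (#|N :&: [set z in t]| <= k)%N; last by lia.
  apply: leq_trans tk; apply: leq_trans (card_size t).
  by apply/subset_leq_card/subsetP => z; rewrite !inE => /andP[].
rewrite -(ler_nat R) natrD; lra.
Qed.

(** The path alternates between [B] and [A], so each round adds two vertices and ends next to [y],
    where it can close. The minimum degrees exceed the at most [k] used vertices by [p * n], so
    fresh continuations abound. *)
Lemma extend_path (delta : R) (A B : {set V}) (y : V) :
    p * n + k%:R <= delta * n ->
    (forall b, b \in B -> E b y) ->
    (forall b, b \in B -> delta * n <= #|[set a in A | E b a]|%:R) ->
    (forall a, a \in A -> delta * n <= #|[set b in B | E a b]|%:R) ->
  forall m r (S : {set V}), path E y r -> uniq (y :: r) -> {subset y :: r <= S} ->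
    last y r \in B -> ((size r).+1 + m.*2)%N = k -> winning m.*2 S.
Proof.
move=> pk By degB degA; elim=> [|m IH] r S pr ur rS lB.
  rewrite addn0 => rk; apply: winning_goal; exists (y :: r); split=> //.
  by rewrite /ucycle ur andbT /= rcons_path pr By.
rewrite doubleS => rk.
have := fresh_vertices (t := y :: r) (degB _ lB) _ pk.
move=> /(_ _)/winning_step; apply; first by move: rk => /=; clear; lia.
move=> a; rewrite !in_set => /andP[aS /andP[aA ea]].
have := fresh_vertices (t := a :: y :: r) (degA _ aA) _ pk.
move=> /(_ _)/winning_step; apply; first by move: rk => /=; clear; lia.
move=> b; rewrite !in_set => /andP[bS /andP[bB eb]].
apply: (IH (rcons (rcons r a) b)).
- by rewrite !rcons_path last_rcons pr ea.
- by rewrite -!rcons_cons !rcons_uniq aS ur mem_rcons inE -in_cons bS.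
- move=> z; rewrite -!rcons_cons mem_rcons [_ \in _ :: _]inE mem_rcons [_ \in _ :: _]inE.
  by rewrite in_setU1 in_setU1 => /or3P[->|->|/rS ->]; rewrite ?orbT.
- by rewrite last_rcons.
- by move: rk; rewrite !size_rcons; clear; lia.
Qed.

(** Drop the edge from the last vertex back to the first and extend the remaining path inside the
    pair given by [dense_core]. As both lengths are odd, an even number of vertices is missing. *)
Lemma winning_odd_cycle (delta : R) (t : seq V) (S : {set V}) :
    0 < delta -> p * n + k%:R <= delta * n -> odd k ->
    ucycle (fun x y => E x y && good_edge E (3 * delta) x y) t ->
    odd (size t) -> (size t <= k)%N -> {subset t <= S} ->
  winning k S.
Proof.
move=> d0 pk ok; case: t => // y r ct ot tk tS.
case/andP: ct => ct ur; move: ct; rewrite /= rcons_path => /andP[pr /andP[exy gxy]].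
have [A [B [xB By degB degA]]] := dense_core Esym d0 gxy V0.
have {}By b : b \in B -> E b y by move/By => /orP[/eqP->|].
apply: (@winning_leq _ _ _ _ (k - (size r).+1)./2.*2); first by move: tk => /=; clear; lia.
apply: (extend_path pk By degB degA _ ur tS xB); last by move: ot tk ok => /=; clear; lia.
by apply: sub_path pr => u v /andP[].
Qed.

Lemma winning_odd_walk (H : rel V) (d delta : R) :
    0 < delta -> p * n + k%:R <= delta * n -> odd k -> (3 <= k)%N ->
    symmetric H -> (forall x y, H x y -> E x y && good_edge E (3 * delta) x y) ->
    (forall x y, H x y -> d * n <= #|[set z | H x z]|%:R) -> 2 <= (d - p) * k%:R ->
  forall j s (S : {set V}), cycle H s -> odd (size s) -> (size s <= k + j)%N ->
    {subset s <= S} -> winning (k + j) S.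
Proof.
move=> d0 pk ok k3 Hsym HE Hdeg dk; elim=> [|j IH] s S cs os sj sS.
- have [t [ct ot ts tS]] := odd_ucycle cs os; rewrite addn0.
  apply: (winning_odd_cycle d0 pk ok _ ot); last by move=> z /tS /sS.
    by case/andP: ct => ct ut; apply/andP; split=> //; apply: sub_cycle HE _ ct.
  by rewrite addn0 in sj; apply: leq_trans sj.
have [sk|ks] := leqP (size s) (k + j).
  by apply: winning_leq (IH _ _ cs os sk sS); rewrite addnS leqnSn.
have n0 : 0 < n by rewrite ltr0n.
(* Double count adjacencies with the walk: there are at least [size s * (d * n)], and the vertices
   having at most two account for at most [2 * n]. *)
rewrite addnS; apply: (@winning_step _ _ _ _ _ _ [set w | 2 < count (H w) s]%N).
  have deg : \sum_w (count (H w) s)%:R = \sum_(v <- s) #|[set z | H v z]|%:R :> R.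
    transitivity (\sum_w \sum_(v <- s) (H w v)%:R : R).
      apply: eq_bigr => w _; rewrite -sum1_count natr_sum [LHS]big_mkcond.
      by apply: eq_bigr => v _; case: ifP.
    rewrite exchange_big; apply: eq_bigr => v _; rewrite natr_card_sum.
    by apply: eq_bigr => w _; rewrite Hsym.
  have low : (size s)%:R * (d * n) <= \sum_(v <- s) #|[set z | H v z]|%:R.
    rewrite mulr_natl -iter_addr_0 -count_predT -big_const_seq big_seq [X in _ <= X]big_seq.
    apply: ler_sum => v vs; have := next_cycle cs vs; exact: Hdeg.
  have high : \sum_w (count (H w) s)%:R
      <= 2 * n + #|[set w | 2 < count (H w) s]%N|%:R * (size s)%:R :> R.
    rewrite mulr_natr -sumr_const natr_card_sum mulr_suml -big_split /=.
    apply: ler_sum => w _; case: ltnP => cw.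
      by rewrite mul1r (le_trans _ (_ : (size s)%:R <= _)) ?lerDr // ler_nat count_size.
    by rewrite mul0r addr0 (ler_nat _ _ 2).
  move: low high; rewrite -deg; set a := #|[set w | _]|%:R; set l := (size s)%:R => low high.
  have kl : k%:R <= l :> R by rewrite ler_nat; rewrite ltnW // (leq_ltn_trans _ ks) ?leq_addr.
  have l0 : 0 < l by rewrite ltr0n; rewrite (leq_ltn_trans _ ks).
  have dp : 2 <= (d - p) * l.
    have k0 : 0 < k%:R :> R by rewrite ltr0n; rewrite (leq_trans _ k3).
    have dp0 : 0 <= d - p by rewrite -(pmulr_lge0 _ k0) (le_trans _ dk).
    by apply: (le_trans dk); rewrite ler_wpM2l.
  rewrite -(ler_pM2r l0).
  have : 0 <= ((d - p) * l - 2) * n by rewrite mulr_ge0 ?subr_ge0 // ltW.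
  have := le_trans low high; nra.
move=> w; rewrite inE => wc.
have [|t [ct ot ts tS]] := shorten_cycle Hsym cs os _ wc.
  have : (3 < size s)%N by rewrite (leq_ltn_trans _ ks) // (leq_trans k3) ?leq_addr.
  by move: os; case: (size s) => [|[|[|[|[]]]]].
apply: (IH t) => //; first by rewrite -ltnS -addnS (leq_trans ts).
by move=> z /tS; rewrite !inE => /orP[->//|/sS ->]; rewrite orbT.
Qed.

Section Growth.
Variables (H : rel V) (U : {set V}).
Hypotheses (Hsym : symmetric H) (HU : forall x y, H x y -> y \in U).

Definition rooted_walk (r : V) (S : {set V}) (m : nat) (b : bool) (v : V) : Prop :=
  exists w, [/\ path H r w, last r w = v, {subset r :: w <= S}, (size w <= m)%N
    & odd (size w) = b].

Definition nbhd (S : {set V}) : {set V} := [set z | [exists v in S, H v z]].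

(** Follow the first walk, then [z] and [z'], then the second walk backwards: the length is three
    plus two numbers of equal parity. *)
Lemma close_walks (r : V) (S : {set V}) m b v v' z z' :
    rooted_walk r S m b v -> rooted_walk r S m b v' -> H v z -> H v' z' -> H z z' ->
  exists s, [/\ cycle H s, odd (size s), (size s <= 2 * m + 3)%N
    & {subset s <= z' |: (z |: S)}].
Proof.
move=> [w [pw lw wS wm ob]] [w' [pw' lw' wS' wm' ob']] vz vz' zz'.
exists ((r :: w) ++ z :: z' :: rev w'); split.
- rewrite cycle_cat rcons_path pw lw vz /= zz' -rev_cons -(belast_rcons r w' z').
  by rewrite -{1}(last_rcons r w' z') rev_path (eq_path (e' := H)) // rcons_path pw' lw' vz'.
- by rewrite size_cat /= size_rev !oddD /= ob ob'; case: (b).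
- by rewrite size_cat /= size_rev; move: wm wm'; clear; lia.
- move=> u; rewrite mem_cat !inE mem_rev.
  by case/orP=> [/wS->|/or3P[->|->|uw]]; rewrite ?orbT // (wS' u) ?orbT // inE uw orbT.
Qed.

(* Colour the neighbourhood of the current connected set by the parity of walks
   from the root: monochromatic edges close odd walks, and if they are few then, by
   the hypothesis on [U], many edges leave the neighbourhood, which can then grow. *)
Lemma winning_growth (d eta : R) (M : nat) (r : V) :
    0 <= p -> 0 < eta -> 0 <= d -> 2 * p <= d ^+ 2 -> 2 * (p + eta) <= d ^+ 2 ->
    (forall (Z : {set V}) (c : pred V), Z \subset U ->
       2 * d * n * #|Z|%:R
       <= 2 * #|[set u : V * V | [&& H u.1 u.2, u.1 \in Z & u.2 \notin Z]]|%:R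
        + #|[set u : V * V | [&& H u.1 u.2, u.1 \in Z, u.2 \in Z & c u.1 == c u.2]]|%:R) ->
    d * n <= #|[set z | H r z]|%:R ->
    (forall s (S : {set V}), cycle H s -> odd (size s) -> (size s <= M)%N ->
       {subset s <= S} -> winning (k + M) S) ->
  forall i m (S : {set V}), r \in S ->
    (forall v, v \in S -> exists b, rooted_walk r S m b v) ->
    n < #|nbhd S|%:R + i%:R * (eta * n) -> (2 * (m + i) + 3 <= M)%N ->
  winning (k + M + 2 + i) S.
Proof.
move=> p0 eta0 d0 pd ped core degr win; have n0 : 0 < n by rewrite ltr0n.
elim=> [|i IH] m S rS conn.
  (* With no enlargement left, the neighbourhood would have more than [n] vertices. *)
  by rewrite mul0r addr0 ltr_nat ltnNge max_card.
move=> big mM.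
set Z := nbhd S in big.
have ZU : Z \subset U.
  by apply/subsetP => z; rewrite inE => /existsP[v /andP[_ /HU]].
(* A vertex reachable with both parities is coloured [true]; all that matters is that the colour is
   attained, which is [cP]. *)
pose c z : bool := `[< exists2 v, H v z & rooted_walk r S m true v >].
have cP z : z \in Z -> exists2 v, H v z & rooted_walk r S m (c z) v.
  rewrite inE => /existsP[v /andP[vS vz]]; case: (boolP (c z)) => [/asboolP//|/asboolPn nc].
  have [[] wv] := conn v vS; last by exists v.
  by case: nc; exists v.
have dZ : d * n <= #|Z|%:R.
  apply: (le_trans degr); rewrite ler_nat subset_leq_card //.
  by apply/subsetP => z; rewrite !inE => rz; apply/existsP; exists r; rewrite rS.
have := core Z c ZU.
set X := (N in _ <= 2 * N%:R + _); set Y := (N in _ <= _ + N%:R) => XY.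
have {}XY : 2 * d ^+ 2 * n ^+ 2 <= 2 * X%:R + Y%:R.
  apply: le_trans XY; have -> : 2 * d ^+ 2 * n ^+ 2 = 2 * d * n * (d * n) by ring.
  by rewrite ler_wpM2l // !mulr_ge0 // ltW.
have [YY|YY] := leP (d ^+ 2 * n ^+ 2) Y%:R.
- have hY : (p + p) * n ^+ 2 <= Y%:R.
    by apply: le_trans YY; rewrite ler_wpM2r ?sqr_ge0 //; lra.
  have h1 := many_heavy_rows
    (P := fun x y => [&& H x y, x \in Z, y \in Z & c x == c y]) V0 p0 hY.
  apply: (@winning_leq _ _ _ _ (k + M).+2); first by clear; lia.
  apply: (winning_step h1) => z; rewrite inE => /winning_step; apply => z'.
  rewrite inE => /and4P[zz' zZ z'Z /eqP cc].
  have [v vz wv] := cP z zZ; have [v' vz' wv'] := cP z' z'Z.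
  rewrite -cc in wv'.
  have [s [cs os sM sS]] := close_walks wv wv' vz vz' zz'.
  by apply: win cs os _ sS; move: sM mM; clear; lia.
- have hX : (p + eta) * n ^+ 2 <= X%:R.
    have : 2 * (p + eta) * n ^+ 2 <= d ^+ 2 * n ^+ 2 by rewrite ler_wpM2r ?sqr_ge0.
    lra.
  have h1 := many_heavy_rows
    (P := fun x y => [&& H x y, x \in Z & y \notin Z]) V0 (ltW eta0) hX.
  rewrite addnS; apply: (winning_step h1) => x; rewrite inE => hx.
  have [y] : exists y, y \in [set y | [&& H x y, x \in Z & y \notin Z]].
    by apply/card_gt0P; rewrite -(ltr_nat R); apply: lt_le_trans hx; rewrite mulr_gt0.
  rewrite inE => /and3P[_ xZ _].
  apply: (IH m.+1); last by move: mM; clear; lia.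
  + by rewrite inE rS orbT.
  + have mono b v : rooted_walk r S m b v -> rooted_walk r (x |: S) m.+1 b v.
      move=> [w [pw lw wS wm ob]]; exists w; split=> //; last by rewrite ltnW.
      by move=> u /wS uS; rewrite inE uS orbT.
    move=> v; rewrite inE => /orP[|/conn [b] /mono wv]; last by exists b.
    rewrite inE => /eqP ->; have [v' v'x [w [pw lw wS wm ob]]] := cP x xZ.
    exists (~~ c x), (rcons w x); split.
    * by rewrite rcons_path pw lw.
    * by rewrite last_rcons.
    * move=> u; rewrite -rcons_cons mem_rcons inE [u \in _ |: _]inE in_set1.
      by case/orP=> [->//|/wS ->]; rewrite orbT.
    * by rewrite size_rcons.
    * by rewrite size_rcons /= ob.
  + have : (#|Z| + #|[set y | [&& H x y, x \in Z & y \notin Z]]| <= #|nbhd (x |: S)|)%N.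
      set Y' := [set y | _]; have <- : (#|Z :|: Y'| = #|Z| + #|Y'|)%N.
        rewrite cardsU -[RHS]subn0; congr (_ - _)%N; apply: eq_card0 => z.
        by rewrite !inE; apply/negP => /and4P[zZ _ _ /negP[]].
      apply/subset_leq_card/subsetP => z; rewrite !inE => /orP[/existsP[v /andP[vS vz]]|].
        by apply/existsP; exists v; rewrite !inE vS orbT.
      by case/and3P=> xz _ _; apply/existsP; exists x; rewrite !inE eqxx.
    rewrite -(ler_nat R) natrD; move: big hx; rewrite -natr1; lra.
Qed.
End Growth.

End Phases.

Lemma winning_far (R : realFieldType) (V : finType) (E : rel V) (eps : R) (k i : nat) :
    symmetric E -> irreflexive E -> 0 < eps -> eps <= 1 ->
    odd k -> 4 < eps * k%:R -> 1 < i%:R * (eps ^+ 2 / 5) ->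
    k%:R <= (eps / 10) ^+ 3 / 6 * #|V|%:R ->
    (forall c : pred V,
       2 * eps * #|V|%:R ^+ 2 <= #|[set u : V * V | E u.1 u.2 && (c u.1 == c u.2)]|%:R) ->
  winning ((eps / 10) ^+ 3 / 6) (cycle_in E k) (k + 3 * i + 6) set0.
Proof.
set n : R := #|V|%:R.
move=> Esym Eirr e0 e1 ok ek ieta kn far.
set p := (eps / 10) ^+ 3 / 6 in kn *.
have e2 : 0 < eps ^+ 2 by rewrite exprn_gt0.
have t0 : 0 < eps / 10 by rewrite divr_gt0.
have t1 : eps / 10 <= 1 by move: e1; clear; lra.
have e3 : 0 < (eps / 10) ^+ 3 by rewrite exprn_gt0.
have e32 : (eps / 10) ^+ 3 <= eps ^+ 2.
  apply: (@le_trans _ _ ((eps / 10) ^+ 2)); first by rewrite exprS ler_piMl // exprn_ge0 ?ltW.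
  by apply: lerXn2r; rewrite ?nnegrE ?(ltW t0) ?(ltW e0) //; move: e0; clear; lra.
have e31 : (eps / 10) ^+ 3 <= eps.
  by apply: (le_trans e32); rewrite expr2 ler_piMl // ltW.
have p0 : 0 < p by rewrite /p; move: e3; clear; lra.
have k4 : 4 < k%:R :> R by apply: (lt_le_trans ek); rewrite ler_piMl.
have n0 : 0 < n.
  by rewrite -(pmulr_rgt0 _ p0); apply: lt_le_trans kn; apply: lt_trans k4.
have V0 : (0 < #|V|)%N by rewrite -(ltr0n R).
have k3 : (3 <= k)%N by rewrite -(ler_nat R) ltW // (lt_trans _ k4) // ltr_nat.
(* [few_bad_edges] with [theta = eps / 10] discards at most a tenth of [eps * n ^+ 2] pairs, so more
   than [2 * d * n ^+ 2] monochromatic ones survive. Moreover [p = delta / 2], leaving room for the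
   [k] used vertices. *)
pose delta := (eps / 10) ^+ 3 / 3; pose d := 9 / 10 * eps.
pose F x y := E x y && good_edge E (3 * delta) x y.
have Fsym : symmetric F by move=> x y; rewrite /F Esym good_edge_sym.
have Ffar (c : pred V) : 2 * d * n ^+ 2
    < #|[set u : V * V | F u.1 u.2 && (c u.1 == c u.2)]|%:R.
  have th0 : 0 <= eps / 10 by move: e0; clear; lra.
  have := few_bad_edges Esym th0; have := far c.
  have -> : (eps / 10) ^+ 3 = 3 * delta by rewrite /delta; field.
  set X := #|_|; set Y := #|_|; set Z := #|_| => XE YE.
  have : (X <= Z + Y)%N.
    apply: leq_trans (leq_card_setU _ _); apply/subset_leq_card/subsetP => u.
    rewrite !inE /F => /andP[-> ->] /=; rewrite andbT; exact: orbN.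
  rewrite -(ler_nat R) natrD; have := mulr_gt0 e0 (exprn_gt0 2 n0).
  by rewrite /d; move: XE YE; clear; lra.
have [U [/set0Pn[r rU] core]] := robust_core Fsym Ffar.
pose H x y := [&& x \in U, y \in U & F x y].
have Hsym : symmetric H by move=> x y; rewrite /H Fsym andbCA.
have HU x y : H x y -> y \in U by case/and3P.
have Hcore (Z : {set V}) (c : pred V) : Z \subset U ->
    2 * d * n * #|Z|%:R
    <= 2 * #|[set u : V * V | [&& H u.1 u.2, u.1 \in Z & u.2 \notin Z]]|%:R
     + #|[set u : V * V | [&& H u.1 u.2, u.1 \in Z, u.2 \in Z & c u.1 == c u.2]]|%:R.
  move=> ZU; apply: (le_trans (core Z c ZU)).
  apply: lerD; [rewrite ler_wpM2l // | ]; rewrite ler_nat subset_leq_card //.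
    apply/subsetP => u; rewrite !inE /H => /and3P[-> uZ /andP[-> ->]].
    by rewrite uZ (subsetP ZU).
  by apply/subsetP => u; rewrite !inE /H => /and4P[-> uZ uZ' ->]; rewrite uZ uZ' !(subsetP ZU).
(* Robustness of the singleton [[set x]] is a minimum degree condition. *)
have Udeg x : x \in U -> d * n <= #|[set z | H x z]|%:R.
  move=> xU; have := Hcore [set x] xpredT; rewrite sub1set xU cards1 => /(_ isT).
  set X := [set u : V * V | _]; set Y := [set u : V * V | _].
  have -> : #|Y| = 0%N.
    apply: eq_card0 => u; rewrite !inE; apply/negP => /and4P[+ /eqP u1 /eqP u2 _].
    by rewrite u1 u2 /H /F Eirr !andbF.
  have : (#|X| <= #|[set z | H x z]|)%N.
    rewrite -(card_imset [set z | H x z] (_ : injective (pair x))); last by move=> ? ? [].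
    apply/subset_leq_card/subsetP => -[u v]; rewrite !inE /= => /and3P[huv /eqP ux _].
    by apply/imsetP; exists v; rewrite ?inE -?ux.
  by rewrite -(ler_nat R); clear; lra.
have Hdeg x y : H x y -> d * n <= #|[set z | H x z]|%:R by case/andP=> /Udeg.
have pdn : p * n <= d * n by rewrite ler_wpM2r ?ltW // /p /d; move: e0 e31; clear; lra.
(* One draw for the root, [i] enlargements, two draws closing an odd walk of length at most
   [2 * i + 3], that many shortenings, and [k] for the final lengthening. *)
have -> : (k + 3 * i + 6 = (k + (2 * i + 3) + 2 + i).+1)%N by clear; lia.
apply: (@winning_step _ _ _ _ _ _ U).
  apply: (le_trans pdn); apply: (le_trans (Udeg r rU)); rewrite ler_nat.
  by apply/subset_leq_card/subsetP => z; rewrite inE => /HU.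
have d0 : 0 < delta by rewrite /delta; move: e3; clear; lra.
have pk : p * n + k%:R <= delta * n.
  by apply: (@le_trans _ _ (p * n + p * n)); rewrite ?lerD2l // /p /delta; clear; lra.
have dk : 2 <= (d - p) * k%:R.
  apply: (@le_trans _ _ (eps / 2 * k%:R)); first by move: ek; clear; lra.
  by rewrite ler_wpM2r // /d /p; move: e0 e31; clear; lra.
move=> x xU; rewrite setU0.
apply: (@winning_growth _ _ E p k V0 H U Hsym HU d (eps ^+ 2 / 5) _ x _ _ _ _ _ Hcore _ _ i 0).
- exact: ltW.
- by move: e2; clear; lra.
- by rewrite /d; move: e0; clear; lra.
- by rewrite /d /p exprMn; move: e2 e32; clear; lra.
- by rewrite /d /p exprMn; move: e2 e32; clear; lra.
- exact: Udeg.
- move=> s S cs os sM sS.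
  have HE u v : H u v -> E u v && good_edge E (3 * delta) u v by case/and3P.
  apply: (winning_odd_walk Esym V0 d0 pk ok k3 Hsym HE Hdeg dk cs os _ sS).
  by rewrite (leq_trans sM) ?leq_addl.
- by rewrite inE.
- move=> v; rewrite inE => /eqP ->; exists false, [::]; split=> // z.
  by rewrite !inE.
- apply: (@lt_le_trans _ _ (i%:R * (eps ^+ 2 / 5) * n)); last by rewrite -mulrA lerDr.
  by rewrite -[ltLHS]mul1r ltr_pM2r.
- by rewrite add0n.
Qed.

(** * Two-colourings of graphs far from free *)

Section Bipartite.
Variables (V : finType).

Lemma alternating_path (e : rel V) (c : pred V) x s :
  (forall x y, e x y -> c x != c y) -> path e x s -> c (last x s) = c x (+) odd (size s).
Proof.
move=> ec; elim: s x => [|y s IH] x /=; first by rewrite addbF.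
move=> /andP[/ec xy /IH ->]; move: xy; case: (c x); case: (c y) => //=;
by case: (odd _).
Qed.

Lemma cycle_bipartite_even (e : rel V) (c : pred V) s :
  (forall x y, e x y -> c x != c y) -> cycle e s -> ~~ odd (size s).
Proof.
case: s => // x s ec cs; have := alternating_path ec cs.
by rewrite last_rcons size_rcons /=; case: (c x); case: (odd _).
Qed.

(** Deleting the monochromatic edges leaves a graph properly coloured by [c], hence without odd
    cycles. The factor 2 arises because each edge is two ordered pairs. *)
Lemma far_monochromatic (R : realType) (L : set nat) (eps : R) (G : sgraph V) :
    (forall l, L l -> odd l) -> far_from_free L eps G -> forall c : pred V,
  2 * eps * #|V|%:R ^+ 2 <= #|[set u : V * V | G u.1 u.2 && (c u.1 == c u.2)]|%:R.
Proof.
move=> Lodd far c; set M := [set u | _].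
pose f (u : V * V) : {set V} := [set u.1; u.2].
have MF : f @: M \subset edges G.
  apply/subsetP => _ /imsetP[u uM ->]; apply/imsetP; exists u => //.
  by move: uM; rewrite !inE => /andP[].
have free : cycles_free L (delete_edges G (f @: M)).
  move=> [l /Lodd ol [_ [s sl /andP[cs _]]]]; move: ol; rewrite -sl; apply/negP.
  apply: (@cycle_bipartite_even _ c) cs => x y /andP[xy]; apply: contra => cxy.
  by apply/imsetP; exists (x, y) => //; rewrite inE /= xy.
have : (2 * #|f @: M| <= #|M|)%N.
  rewrite -[#|M|]sum1_card (partition_big_imset f) /= mulnC -sum_nat_const.
  apply: leq_sum => _ /imsetP[[x y] xyM ->]; rewrite sum1dep_card.
  have xy : (x, y) != (y, x).
    apply/eqP => -[yx _]; move: xyM; rewrite inE /= yx.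
    by rewrite adj_irr.
  apply: (@leq_trans #|[set (x, y); (y, x)]|); first by rewrite cards2 xy.
  apply/subset_leq_card/subsetP => u; rewrite !inE => /orP[] /eqP -> /=.
    by move: xyM; rewrite inE eqxx andbT.
  move: xyM; rewrite inE /= adj_sym eq_sym => -> /=.
  by rewrite /f /= setUC.
rewrite -(ler_nat R) natrM; have := far _ MF free; lra.
Qed.

Lemma has_cycle_induced (L : set nat) (G : sgraph V) (k : nat) (X : {set V}) :
  L k -> (3 <= k)%N -> cycle_in G k X -> has_cycle_in L (induced G X).
Proof.
move=> Lk k3 [s [sk /andP[cs us] sX]]; exists k => //; split=> //.
have /all_sigP[s' es] : all (mem X) s by apply/allP.
exists s'; first by rewrite -sk es size_map.
apply/andP; split; last by rewrite es map_inj_uniq // in us; exact: val_inj.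
by move: cs; rewrite es cycle_map.
Qed.

End Bipartite.

(** * Sample size and the final bound *)

(** Bernoulli's inequality gives [2 <= (1 + p / 2) ^+ a], and [(1 - p / 2) * (1 + p / 2) <= 1]. *)
Lemma bernoulli_half (R : realFieldType) (p : R) (a : nat) :
  0 <= p <= 1 -> 2 <= a%:R * p -> (1 - p / 2) ^+ a <= 1 / 2.
Proof.
move=> p01 ap; have bern (b : nat) : 1 + b%:R * (p / 2) <= (1 + p / 2) ^+ b.
  elim: b => [|b IH]; first by rewrite mul0r addr0 expr0.
  rewrite exprS; apply: (@le_trans _ _ ((1 + p / 2) * (1 + b%:R * (p / 2)))).
    rewrite -natr1; have : 0 <= b%:R * (p / 2) * (p / 2).
      by rewrite mulr_ge0 ?mulr_ge0 //; lra.
    lra.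
  by rewrite ler_wpM2l //; lra.
have lo : 2 <= (1 + p / 2) ^+ a by apply: le_trans (bern a); lra.
have r0 : 0 <= (1 - p / 2) ^+ a by rewrite exprn_ge0 //; lra.
have : (1 - p / 2) ^+ a * (1 + p / 2) ^+ a <= 1.
  by rewrite -exprMn exprn_ile1 //; nra.
nra.
Qed.

(** Every [a] draws halve the bound on the failure probability. Two blocks more than the
    [k + 3 * i + 6] advances cancel the power of 2 in [failing_samples] and leave 1/4. *)
Lemma far_sample_suffices (R : realType) (L : set nat) (eps : R) (k i a : nat) :
    L k -> (forall l, L l -> odd l) -> 0 < eps -> eps <= 1 ->
    4 < eps * k%:R -> 1 < i%:R * (eps ^+ 2 / 5) -> 2 <= a%:R * ((eps / 10) ^+ 3 / 6) ->
  sample_suffices L eps (a * (k + 3 * i + 8)).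
Proof.
move=> Lk Lodd e0 e1 ek ieta ap.
have e3 : 0 < (eps / 10) ^+ 3 <= 1.
  by rewrite exprn_gt0 ?exprn_ile1 ?divr_gt0 //; move: e0 e1; clear; lra.
set p := (eps / 10) ^+ 3 / 6 in ap *.
have p0 : 0 < p by rewrite /p; move: e3; clear; lra.
have p01 : 0 <= p <= 1 by rewrite /p; move: e3; clear; lra.
have k4 : 4 < k%:R :> R by apply: (lt_le_trans ek); rewrite ler_piMl.
have k3 : (3 <= k)%N by rewrite -(ler_nat R) ltW // (lt_trans _ k4) // ltr_nat.
exists (Num.truncn (k%:R / p)).+1 => V G nV far.
have kn : k%:R <= p * #|V|%:R.
  rewrite mulrC -ler_pdivrMr //; apply: ltW; apply: lt_le_trans (truncnS_gt _) _.
  by rewrite ler_nat.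
have n0 : 0 < #|V|%:R :> R by rewrite ltr0n; case: #|V| nV.
have win := winning_far (@adj_sym _ G) (@adj_irr _ G) e0 e1 (Lodd _ Lk) ek ieta kn
  (far_monochromatic Lodd far).
set T := (k + 3 * i + 6)%N in win; set q := (a * _)%N.
have goalS (S S' : {set V}) : S \subset S' -> cycle_in G k S -> cycle_in G k S'.
  by move=> SS' [s [sk us sS]]; exists s; split=> // z /sS /(subsetP SS').
have fail := failing_samples goalS q p01 win.
set B := [pred f : {ffun 'I_q -> V} | _] in fail.
rewrite /sample_prob; set A := [pred f | _].
have AB : (#|V| ^ q <= #|A| + #|B|)%N.
  rewrite -[q in (_ ^ q)%N]card_ord -card_ffun -cardUI.
  apply: leq_trans (leq_addr _ _); apply/subset_leq_card/subsetP => f _; rewrite !inE.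
  rewrite set0U; case: asboolP => //= nA; apply/asboolPn => cX.
  exact: nA (has_cycle_induced Lk k3 cX).
have hB : #|B|%:R <= (#|V| ^ q)%:R / 3 :> R.
  apply: (le_trans fail); rewrite exprMn mulrA natrX mulrC ler_wpM2l ?exprn_ge0 ?ler0n //.
  have -> : q = (a * T.+2)%N by rewrite /q /T; congr (_ * _)%N; clear; lia.
  rewrite exprM; have hp := bernoulli_half p01 ap.
  have h0 : 0 <= (1 - p / 2) ^+ a by rewrite exprn_ge0 //; move: p01; clear; lra.
  apply: (@le_trans _ _ (2 ^+ T * (1 / 2) ^+ T.+2)).
    rewrite ler_wpM2l ?exprn_ge0 //.
    by apply: lerXn2r hp; rewrite nnegrE // divr_ge0.
  rewrite !exprSr !mulrA -exprMn (_ : 2 * (1 / 2) = 1); last by field.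
  by rewrite expr1n; clear; lra.
have nq : 0 < (#|V| ^ q)%:R :> R by rewrite natrX exprn_gt0.
rewrite ler_pdivlMr //; move: AB; rewrite -(ler_nat R) natrD; move: hB nq; clear; lra.
Qed.

Theorem theorem2p3 (R : realType) :
  exists2 K : R, 0 < K &
  forall (g : nat -> nat) (l1 : nat),
    (forall x, odd x -> odd (g x)) ->
    (forall x y, odd x -> odd y -> (x < y)%N -> (g x < g y)%N) ->
    (forall x, odd x -> (x < g x)%N) ->
    odd l1 -> (3 <= l1)%N ->
    let L : set nat := range (fun i : nat => iter i g l1) in
    forall eps : R, 0 < eps -> eps <= 1 / (4 * l1%:R) ->
    let gm : nat := g (largest_odd (4 / eps)) in
    exists2 w : nat, is_w L eps w &
      w%:R <= K * eps ^- 8 * gm%:R * ln gm%:R.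
Proof.
(* The argument gives the factor [351 * 10 ^+ 3]; replacing 1 by a logarithm that is at least 1/2
   doubles it. *)
exists (10 ^+ 6); first by rewrite exprn_gt0.
move=> g l1 godd gmono ggt ol1 l13 L eps e0 el1 gm.
have Lodd l : L l -> odd l.
  by move=> [i _ <-]; elim: i => //= i; exact: godd.
have l1R : 3 <= l1%:R :> R by rewrite ler_nat.
have l1e : 16 * l1%:R <= 4 / eps.
  move: el1; rewrite ler_pdivlMr ?mulr_gt0 //; last by lra.
  by rewrite ler_pdivlMr //; lra.
have e1 : eps <= 1.
  by apply: (le_trans el1); rewrite ler_pdivrMr ?mul1r; lra.
set m := largest_odd (4 / eps) in gm *.
have max_m l : odd l -> l%:R <= 4 / eps -> (l <= m)%N.
  move=> ol le; have ll : (l < (Num.truncn (4 / eps)).+1)%N.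
    by rewrite ltnS truncn_ge_nat // ltW // divr_gt0.
  exact: (@leq_bigmax_cond _ (fun k : 'I__ => odd k) (fun k => k : nat) (Ordinal ll)).
have l1m : (l1 <= m)%N by apply: max_m => //; lra.
have om : odd m.
  have : odd m || (m == 0%N).
    rewrite /m /largest_odd; elim/big_ind: _ => // [u v ou ov|j ->//].
    by rewrite /maxn; case: ifP.
  by case/orP=> // /eqP m0; move: l1m; rewrite m0 leqNgt (leq_trans _ l13).
have iter_odd i : odd (iter i g l1) by apply: Lodd; exists i.
have iter_ge i : (i <= iter i g l1)%N.
  elim: i => //= i IH; apply: leq_ltn_trans IH _; exact: ggt.
have exm : exists i, (m < iter i g l1)%N by exists m.+1.
have [i mi imin] := ex_minnP exm.
(* The preceding element of [L] is at most [m], so monotonicity of [g] applies; it exists because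
   [l1 <= m]. *)
have kgm : (iter i g l1 <= gm)%N.
  case: i mi imin => [|i] mi imin; first by move: mi; rewrite /= ltnNge l1m.
  have : (iter i g l1 <= m)%N by rewrite leqNgt; apply/negP => /imin; rewrite ltnn.
  rewrite leq_eqVlt => /orP[/eqP im|lt]; first by rewrite /gm -im.
  by apply: ltnW; exact: gmono (iter_odd i) om lt.
have Lk : L (iter i g l1) by exists i.
move: kgm Lk (iter_odd i) mi; set k := iter i g l1 => kgm Lk ok mi.
have k4 : 4 < eps * k%:R.
  rewrite mulrC -ltr_pdivrMr // ltNge; apply/negP => /(max_m _ ok).
  by rewrite leqNgt mi.
pose x := eps^-1; have x1 : 1 <= x by rewrite invr_ge1 // unitfE gt_eqF.
have x0 : 0 < x by rewrite invr_gt0.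
(* The thresholds required by [far_sample_suffices] are [2 / p], with [p = (eps / 10) ^+ 3 / 6], for
   [a] and [5 / eps ^+ 2] for [j]. *)
pose a := (Num.truncn (12 * 10 ^+ 3 * x ^+ 3)).+1.
pose j := (Num.truncn (5 * x ^+ 2)).+1.
have xe : x * eps = 1 by rewrite mulVf // gt_eqF.
have ja : 1 < j%:R * (eps ^+ 2 / 5).
  have e : 5 * x ^+ 2 * (eps ^+ 2 / 5) = 1.
    by transitivity ((x * eps) ^+ 2); [field | rewrite xe expr1n].
  by rewrite -[ltLHS]e ltr_pM2r ?truncnS_gt // divr_gt0 // exprn_gt0.
have ap : 2 <= a%:R * ((eps / 10) ^+ 3 / 6).
  have e : 12 * 10 ^+ 3 * x ^+ 3 * ((eps / 10) ^+ 3 / 6) = 2.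
    by transitivity (2 * (x * eps) ^+ 3); [field | rewrite xe expr1n mulr1].
  by rewrite -[leLHS]e ler_pM2r ?(ltW (truncnS_gt _)) // !divr_gt0 // exprn_gt0 // divr_gt0.
have samp := far_sample_suffices Lk Lodd e0 e1 k4 ja ap.
have exq : exists q, `[< sample_suffices L eps q >] by eexists; apply/asboolP; exact: samp.
have [w /asboolP ws wmin] := ex_minnP exq.
exists w; first by split=> // q' qs; apply: wmin; apply/asboolP.
have wq : (w <= a * (k + 3 * j + 8))%N by apply: wmin; apply/asboolP.
have x_ge n : 1 <= x ^+ n by exact: exprn_ege1.
have a_le : a%:R <= 13 * 10 ^+ 3 * x ^+ 3.
  have -> : a%:R = (Num.truncn (12 * 10 ^+ 3 * x ^+ 3))%:R + 1 :> R by rewrite natr1.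
  apply: (@le_trans _ _ (12 * 10 ^+ 3 * x ^+ 3 + 10 ^+ 3 * x ^+ 3)); last by clear; lra.
  apply: lerD; first by rewrite truncn_le !mulr_ge0 ?exprn_ge0 ?(ltW x0).
  by rewrite mulr_ege1 // exprn_ege1 // ler1n.
have j_le : j%:R <= 6 * x ^+ 2.
  have -> : j%:R = (Num.truncn (5 * x ^+ 2))%:R + 1 :> R by rewrite natr1.
  apply: (@le_trans _ _ (5 * x ^+ 2 + x ^+ 2)); last by clear; lra.
  by apply: lerD => //; rewrite truncn_le mulr_ge0 ?exprn_ge0 ?(ltW x0).
have k1 : 1 <= k%:R :> R by rewrite ler1n; case: (k) mi.
have kg : k%:R <= gm%:R :> R by rewrite ler_nat.
have g2 : 2 <= gm%:R :> R.
  apply: le_trans kg; rewrite ler_nat.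
  exact: leq_trans (ltnW l13) (leq_trans l1m (ltnW mi)).
have g0 : 0 < gm%:R :> R by apply: lt_le_trans g2.
(* From [ln y <= y - 1] at the inverse of [gm], which is at most 1/2. *)
have lngm : 1 / 2 <= ln gm%:R :> R.
  have gi : gm%:R^-1 <= 2^-1 :> R by rewrite lef_pV2 // posrE.
  have gi0 : 0 < gm%:R^-1 :> R by rewrite invr_gt0.
  have h : ln (1 + (gm%:R^-1 - 1)) <= gm%:R^-1 - 1 :> R.
    by apply: le_ln1Dx; rewrite ltrBrDr addNr.
  rewrite subrKC lnV ?posrE // in h; move: h gi; clear; lra.
have w_le : w%:R <= a%:R * (k%:R + 3 * j%:R + 8) :> R.
  have -> : k%:R + 3 * j%:R + 8 = (k + 3 * j + 8)%:R :> R by rewrite !natrD natrM.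
  by rewrite -natrM ler_nat.
have xk : k%:R + 3 * j%:R + 8 <= 27 * x ^+ 2 * k%:R.
  have : 0 <= (x ^+ 2 - 1) * k%:R by rewrite mulr_ge0 ?subr_ge0.
  have : 0 <= x ^+ 2 * (k%:R - 1) by rewrite mulr_ge0 ?subr_ge0 // (le_trans _ (x_ge 2)).
  move: j_le k1; have := x_ge 2; clear; lra.
have x0n n : 0 <= x ^+ n by rewrite exprn_ge0 // ltW.
have k0 : 0 <= k%:R :> R by [].
have g0' := ltW g0.
have wx : w%:R <= 351 * 10 ^+ 3 * (x ^+ 5 * k%:R).
  apply: (le_trans w_le); apply: le_trans (ler_pM _ _ a_le xk) _ => //.
    by rewrite !addr_ge0 // mulr_ge0.
  by rewrite le_eqVlt; apply/orP; left; apply/eqP; ring.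
apply: (le_trans wx); rewrite -exprVn -/x.
apply: (@le_trans _ _ (351 * 10 ^+ 3 * (x ^+ 8 * gm%:R))).
  by rewrite ler_wpM2l ?mulr_ge0 ?exprn_ge0 // ler_pM // ler_weXn2l.
have z0 : 0 <= x ^+ 8 * gm%:R by rewrite mulr_ge0.
have zl : x ^+ 8 * gm%:R * (1 / 2) <= x ^+ 8 * gm%:R * ln gm%:R by rewrite ler_wpM2l.
rewrite -(mulrA _ (x ^+ 8)).
apply: (@le_trans _ _ (10 ^+ 6 * (x ^+ 8 * gm%:R * (1 / 2)))).
  by move: (x ^+ 8 * _) z0 => z; clear; lra.
by rewrite -[leRHS]mulrA ler_wpM2l // exprn_ge0.
Qed.
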